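(* Fix $k\ge1$ and $\rho>0$. Suppose that $\rho'\mapsto\lim_{V\to\infty}\langle N_k/V\rangle^{GC}_V(\mu_V(\rho'))$ and $\rho'\mapsto\tilde{\mathbb{K}}(\rho';[\rho,\infty))$ are continuous at $\rho'=\rho$, and that $\tilde{\mathbb{K}}(\rho;[\rho,\infty))\neq0$. Then $\lim_{V\to\infty}\langle N_k/V\rangle^{GC}_V(\mu_V(\rho))=0$ implies $\lim_{V\to\infty}\langle N_k/V\rangle^{C}_V(\rho)=0$.
   Context: Fix exponents $\alpha_1\ge\alpha_2\ge\alpha_3>0$ with $\alpha_1+\alpha_2+\alpha_3=1$, $\Lambda_V=\{x\in\mathbb{R}^3:0\le x_j\le V^{\alpha_j}\}$, one-particle Hamiltonian $-\Delta/2$ on $L^2(\Lambda_V)$ with Dirichlet boundary conditions, eigenvalues $E_1(V)<E_2(V)\le\dots$, and $N_k$ the occupation number of the $k$-th eigenstate. Perfect Bose gas at inverse temperature $\beta>0$. Canonical state at density $\rho=n/V$: $\langle\cdot\rangle^C_V(\rho)=Z_V(n)^{-1}\mathrm{Tr}(\cdot\,e^{-\beta T_V^{(n)}})$ on the symmetric $n$-particle space. Grand-canonical state at $\mu<E_1(V)$: $\langle\cdot\rangle^{GC}_V(\mu)=\Xi_V(\mu)^{-1}\mathrm{Tr}_{\text{Fock}}(\cdot\,e^{-\beta(T_V-\mu N_V)})$, $N_V=\sum_kN_k$. $\mu_V(\rho)$ is the unique $\mu<E_1(V)$ with $V^{-1}\langle N_V\rangle^{GC}_V(\mu)=\rho$.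 The Kac distribution $\tilde{\mathbb{K}}_V(\rho;dx)$ is the probability distribution of $N_V/V$ in the state $\langle\cdot\rangle^{GC}_V(\mu_V(\rho))$, so that $\langle\cdot\rangle^{GC}_V(\mu_V(\rho))=\int_{[0,\infty)}\langle\cdot\rangle^{C}_V(x)\,\tilde{\mathbb{K}}_V(\rho;dx)$; $\tilde{\mathbb{K}}(\rho;dx)=\lim_{V\to\infty}\tilde{\mathbb{K}}_V(\rho;dx)$ is its limit. Canonical limits at fixed density $\rho$ are taken with $n$ particles in volume $V=n/\rho$, $n\to\infty$. *)

(* Defs.v *)
(* Perfect Bose gas in the anisotropic Dirichlet box
   Lambda_V = [0,V^a1] x [0,V^a2] x [0,V^a3]. *)
From mathcomp Require Import all_boot all_order all_algebra.
From mathcomp Require Import all_classical all_reals all_analysis.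
Import Order.TTheory GRing.Theory Num.Theory.
Import numFieldNormedType.Exports.
Unset Printing Implicit Defensive.
Local Open Scope classical_set_scope.
Local Open Scope ring_scope.

Section PerfectBoseGas.
Variable R : realType.
(* exponents a1 >= a2 >= a3 > 0, a1+a2+a3 = 1, and inverse temperature beta *)
Variables (a1 a2 a3 beta : R).

(* Eigenvalue of -Delta/2 with Dirichlet b.c. on Lambda_V for the eigenfunction
   prod_j sin((m_j+1) pi x_j / V^{a_j}),  m_j : nat  (so quantum numbers >= 1). *)
Definition Eone (V : R) (m : nat * nat * nat) : R :=
  pi ^+ 2 / 2 *
  ((m.1.1.+1)%:R ^+ 2 / (V `^ a1) ^+ 2
 + (m.1.2.+1)%:R ^+ 2 / (V `^ a2) ^+ 2
 + (m.2.+1)%:R ^+ 2 / (V `^ a3) ^+ 2).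

(* E_k(V), k >= 1 : the k-th eigenvalue counted with multiplicity,
   E_1(V) < E_2(V) <= ... : the least lam such that at least k
   (distinct) eigenstates have eigenvalue <= lam. *)
Definition Eig (V : R) (k : nat) : R :=
  inf [set lam : R | exists f : 'I_k -> nat * nat * nat,
         injective f /\ forall i, Eone V (f i) <= lam].

(* Occupation-number basis of the symmetric n-particle space: a basis vector is
   a multiset of n one-particle states (indices l >= 1), i.e. a sorted n-tuple. *)
Definition basis (n : nat) : set (n.-tuple nat) :=
  [set t | sorted leq t /\ all (fun l => 0 < l)%N t].

(* <t| exp(-beta T_V^(n)) |t> *)
Definition weight (V : R) (n : nat) (t : n.-tuple nat) : R :=
  expR (- beta * \sum_(l <- t) Eig V l).

(* canonical partition function Z_V(n) = Tr exp(-beta T_V^(n)) *)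
Definition Zc (V : R) (n : nat) : R :=
  fine (\esum_(t in basis n) (weight V n t)%:E)%E.

Definition TrNk (V : R) (n k : nat) : R :=
  fine (\esum_(t in basis n) ((count_mem k t)%:R * weight V n t)%:E)%E.

(* canonical expectation <N_k / V>^C_V(rho) with n = rho V particles *)
Definition canNk (V : R) (n k : nat) : R := TrNk V n k / Zc V n / V.

(* grand-canonical partition function Xi_V(mu) = Tr_Fock exp(-beta(T_V - mu N_V)) *)
Definition Xi (V mu : R) : R :=
  fine (\esum_(n in [set: nat]) (expR (beta * mu * n%:R) * Zc V n)%:E)%E.

Definition gcN (V mu : R) : R :=
  fine (\esum_(n in [set: nat]) (n%:R * expR (beta * mu * n%:R) * Zc V n)%:E)%E
  / Xi V mu.

Definition gcNk (V mu : R) (k : nat) : R :=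
  fine (\esum_(n in [set: nat]) (expR (beta * mu * n%:R) * TrNk V n k)%:E)%E
  / Xi V mu.

(* mu_V(rho): the (unique) mu < E_1(V) with V^{-1} <N_V>^GC_V(mu) = rho *)
Definition muV (V rho : R) : R :=
  xget 0 [set mu | mu < Eig V 1 /\ gcN V mu / V = rho].

Definition gcNk_rho (V rho : R) (k : nat) : R := gcNk V (muV V rho) k / V.

(* Kac distribution tilde K_V(rho; .) = law of N_V/V in <.>^GC_V(mu_V(rho)):
   it gives mass kacw V rho n = P(N_V = n) to the point n/V. *)
Definition kacw (V rho : R) (n : nat) : R :=
  expR (beta * muV V rho * n%:R) * Zc V n / Xi V (muV V rho).

Definition kac_integral (V rho : R) (g : R -> R) : R :=
  limn (fun N => \sum_(0 <= n < N) (kacw V rho n * g (n%:R / V))).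

Definition kac_weak_limit (rho : R) (K : probability R R) : Prop :=
  forall g : R -> R, continuous g -> (exists M : R, forall x, `|g x| <= M) ->
    (fun V => kac_integral V rho g) @ +oo --> \int[K]_x g x.

End PerfectBoseGas.

(* Main.v *)
(** With [x_l = exp (- beta E_l)], the canonical partition function [Z(n)] is the
    complete homogeneous symmetric function of degree [n] in the [x_l], hence
    log-concave in [n].  Therefore the canonical occupation
    [sum_(j >= 1) x_k ^ j Z(n - j) / Z(n)] of level [k] is nondecreasing in [n];
    and the law of [N_V] in the grand-canonical state is log-concave, so it gives
    mass at least [1/4] to the half-line starting at its mean.  With [V = n / rho]
    this mean is exactly [n], whence
    [<N_k/V>^C_V(rho) <= 4 <N_k/V>^GC_V(mu_V(rho))]. *)
Require Import Defs.
From mathcomp Require Import all_boot all_order all_algebra.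
From mathcomp Require Import all_classical all_reals all_analysis.
From mathcomp Require Import ring lra zify.
Import Order.TTheory GRing.Theory Num.Theory.
Import numFieldNormedType.Exports.
Set Implicit Arguments.
Unset Strict Implicit.
Unset Printing Implicit Defensive.
Local Open Scope classical_set_scope.
Local Open Scope ring_scope.

(** * Log-concave sequences, and the mass of a log-concave law above its mean *)

Section LogConcave.
Variable R : realFieldType.
Implicit Types u v : nat -> R.

(** Adjoining one level convolves the partition functions with a geometric sequence, and this
    preserves log-concavity; so log-concavity is proved for finitely many levels and carried to the
    limit. That limit is finite thanks to a bound uniform in the number of levels, which rests on
    the summability of the Boltzmann factors, hence on a polynomial count of the eigenvalues. For a
    general law the mass above the mean can be arbitrarily small, because a rare but huge value can
    hold the mean up. Log-concavity excludes this: a single ratio, taken at the mean, dominates the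
    upper tail by a geometric sequence and also limits the deficit below the mean. What matters for
    the limit is that the constant 1/4 does not depend on [V]. The mean equals n only if [muV]
    really solves its equation, so existence has to be proved. It comes from the lowest level: at a
    suitable fugacity that level alone would carry n particles on average, and the other levels only
    raise the mean. *)

Definition log_concave u := forall n, u n * u n.+2 <= u n.+1 ^+ 2.

(** The ratios [u n.+1 / u n] are nonincreasing; this is the form without division. *)
Lemma log_concave_ratio u p q : (forall n, 0 < u n) -> log_concave u ->
  (p <= q)%N -> u p * u q.+1 <= u p.+1 * u q.
Proof.
move=> u0 lcu; elim: q => [|q IH].
  by rewrite leqn0 => /eqP ->; rewrite mulrC.
rewrite leq_eqVlt => /orP[/eqP ->|]; first by rewrite mulrC.
rewrite ltnS => /IH {}IH; rewrite -(ler_pM2r (u0 q)).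
have h1 : u p * (u q * u q.+2) <= u p * u q.+1 ^+ 2 by rewrite ler_pM2l.
have h2 : u p * u q.+1 * u q.+1 <= u p.+1 * u q * u q.+1 by rewrite ler_pM2r.
by move: h1 h2; nra.
Qed.

(* [v] is the convolution of [u] with the geometric sequence [y ^+ n]. *)
Lemma log_concave_geometric_conv u v y : (forall n, 0 < u n) ->
  log_concave u -> 0 < y -> v 0%N = u 0%N ->
  (forall n, v n.+1 = u n.+1 + y * v n) -> log_concave v.
Proof.
move=> u0 lcu y0 v0 vS n.
(* [v m] is a positive combination of the [u i] with [i <= m], so it inherits their ratio inequality
   against [u N]. In the case [N = m.+1] this yields the claim, since the terms [y * v n * v n.+1]
   cancel. *)
have key m N : (m <= N)%N -> v m * u N.+1 <= v m.+1 * u N.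
  elim: m => [_|m IH mN].
    rewrite vS v0 mulrDl ler_wpDr//; last exact: log_concave_ratio.
    by rewrite !mulr_ge0// ltW.
  rewrite vS [v m.+2]vS !mulrDl lerD//; first exact: log_concave_ratio.
  by rewrite -!mulrA ler_pM2l//; exact: IH (ltnW mN).
have K := key n n.+1 (leqnSn _); rewrite [v n.+2]vS expr2 {3}vS.
by lra.
Qed.

(** Unrolled, [t n] is the sum of [y ^+ j * u (n - j)] over [1 <= j <= n]. Each [u (n - j) / u n]
    increases with [n] by log-concavity, and each new term is positive. *)
Lemma ratio_homo_geometric_conv u t y n : (forall n, 0 < u n) ->
  log_concave u -> 0 < y -> t 0%N = 0 ->
  (forall n, t n.+1 = y * (u n + t n)) -> t n / u n <= t n.+1 / u n.+1.
Proof.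
move=> u0 lcu y0 t0 tS.
have t_ge0 m : 0 <= t m.
  elim: m => [|m IH]; first by rewrite t0.
  by rewrite tS mulr_ge0 ?addr_ge0// ltW.
have key m N : (m <= N)%N -> t m * u N.+1 <= t m.+1 * u N.
  elim: m => [_|m IH mN]; first by rewrite t0 mul0r mulr_ge0// ltW.
  rewrite tS [t m.+2]tS -!mulrA ler_pM2l// !mulrDl lerD//.
    exact: log_concave_ratio (ltnW mN).
  exact: IH (ltnW mN).
by rewrite ler_pdivrMr// mulrAC ler_pdivlMr//; exact: key.
Qed.

Lemma bernoulli_le1 (s : R) M : 0 <= s <= 1 -> 1 - M%:R * (1 - s) <= s ^+ M.
Proof.
move=> /andP[s0 s1]; elim: M => [|M IH]; first by rewrite expr0 mul0r subr0.
rewrite exprSr -natr1.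
have sM1 : s ^+ M <= 1 by rewrite exprn_ile1.
have : 0 <= (s ^+ M - (1 - M%:R * (1 - s))) * s.
  by rewrite mulr_ge0// subr_ge0.
have : 0 <= M%:R * (1 - s) * (1 - s) :> R by rewrite !mulr_ge0// subr_ge0.
by lra.
Qed.

(* Put [a = G n] and [s = G n.+1 / a]; log-concavity bounds [G j] by the geometric
   sequence [a * s ^ (j - n)] on both sides of [n].  If [M] is least with
   [G (n - M) > G 0 / 2], the [M] indices up to [n] contribute a deficit at least
   [M * G 0 / 2], and the indices above [n] at most [a * s / (1 - s)], so
   [s ^ M >= 1 - 2 * a * s / G 0] by Bernoulli. *)
Lemma log_concave_tail_mean (G : nat -> R) n : (forall j, 0 < G j) ->
  log_concave G -> (forall j, G j.+1 < G j) ->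
  (forall e, 0 < e -> exists N, n%:R * G 0%N - e < \sum_(j < N) G j.+1) ->
  G 0%N <= 4 * G n.
Proof.
move=> G0 lcG Gdec mean.
set S := G 0%N; set a := G n; set s := G n.+1 / a.
have a0 : 0 < a by exact: G0.
have S0 : 0 < S by exact: G0.
have s0 : 0 < s by rewrite divr_gt0.
have s1 : s < 1 by rewrite ltr_pdivrMr// mul1r Gdec.
have Gle i j : (i <= j)%N -> G j <= G i.
  move=> /subnK <-; elim: (j - i)%N => // d IH.
  by rewrite addSn (le_trans (ltW (Gdec _))).
have GS : G n.+1 = s * a by rewrite /s divfK// gt_eqF.
have up i : G (n + i)%N <= a * s ^+ i.
  elim: i => [|i IH]; first by rewrite addn0 mulr1.
  have := log_concave_ratio G0 lcG (leq_addr i n); rewrite GS -/a addnS => h.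
  have : a * G (n + i).+1 <= a * (a * s ^+ i.+1).
    have : s * a * G (n + i)%N <= s * a * (a * s ^+ i).
      by rewrite ler_pM2l// mulr_gt0.
    by rewrite exprS; lra.
  by rewrite ler_pM2l.
have down i : (i <= n)%N -> G (n - i)%N * s ^+ i <= a.
  elim: i => [|i IH ltin]; first by rewrite subn0 mulr1.
  have e : (n - i = (n - i.+1).+1)%N by rewrite subnSK.
  have := @log_concave_ratio _ (n - i.+1) n G0 lcG (leq_subr _ _).
  rewrite GS -/a -e mulrA ler_pM2r// exprS => h.
  apply: le_trans (IH (ltnW ltin)).
  by rewrite mulrA ler_wpM2r// exprn_ge0// ltW.
have exM : exists M, S < 2 * G (n - M)%N.
  by exists n; rewrite subnn -/S; lra.
case: (ex_minnP exM) => M SM minM.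
have Mn : (M <= n)%N.
  by apply: minM; rewrite subnn -/S; lra.
have small j : (n - M < j <= n)%N -> 2 * G j <= S.
  move=> /andP[ltj jn]; rewrite leNgt; apply/negP => SGj.
  by have := minM (n - j)%N; rewrite subKn// => /(_ SGj); lia.
have lowsum : \sum_(j < n) G j.+1 <= n%:R * S - M%:R * (S / 2).
  have -> : \sum_(j < n) G j.+1 = \sum_(0 <= j < n) G j.+1 by rewrite big_mkord.
  rewrite (@big_cat_nat _ _ _ (n - M))//= ?leq_subr//.
  have h1 : \sum_(0 <= j < n - M) G j.+1 <= (n - M)%:R * S.
    rewrite mulr_natl -[X in _ *+ X]subn0 -sumr_const_nat.
    by apply: ler_sum => j _; exact: Gle.
  have h2 : \sum_(n - M <= j < n) G j.+1 <= M%:R * (S / 2).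
    rewrite mulr_natl -[X in _ *+ X](subKn Mn) -sumr_const_nat.
    rewrite big_nat_cond [leRHS]big_nat_cond.
    apply: ler_sum => j /andP[ljn _].
    by have := small j.+1; rewrite ltnS => /(_ ljn); lra.
  by apply: le_trans (lerD h1 h2) _; rewrite natrB//; lra.
have highsum N : \sum_(j < N) G (n + j).+1 <= a * s / (1 - s).
  have : \sum_(j < N) G (n + j).+1 <= a * s / (1 - s) * (1 - s ^+ N).
    elim: N => [|N IH]; first by rewrite big_ord0 expr0 subrr mulr0.
    rewrite big_ord_recr/= -addnS; apply: le_trans (lerD IH (up N.+1)) _.
    have e : a * s ^+ N.+1 = a * s / (1 - s) * (s ^+ N * (1 - s)).
      by rewrite exprS; field; rewrite subr_eq0 gt_eqF.
    by rewrite e -mulrDr exprS le_eqVlt; apply/orP; left; apply/eqP; ring.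
  move/le_trans; apply.
  have c0 : 0 <= a * s / (1 - s).
    by apply: divr_ge0; [apply: mulr_ge0|rewrite subr_ge0]; exact: ltW.
  by rewrite ler_piMr// gerBl exprn_ge0// ltW.
have total N : \sum_(j < N) G j.+1 <= n%:R * S - M%:R * (S / 2) + a * s / (1 - s).
  apply: (@le_trans _ _ (\sum_(j < n + N) G j.+1)).
    rewrite addnC big_split_ord/= ler_wpDr// sumr_ge0// => j _; exact: ltW.
  by rewrite big_split_ord/=; exact: lerD lowsum (highsum N).
have MS : M%:R * (S / 2) <= a * s / (1 - s).
  rewrite leNgt; apply/negP => lt.
  have [N] := mean (M%:R * (S / 2) - a * s / (1 - s)) ltac:(by rewrite subr_gt0).
  by have := total N; rewrite -/S; lra.
have MS' : M%:R * (1 - s) * S <= 2 * a * s.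
  by move: MS; rewrite ler_pdivlMr ?subr_gt0//; lra.
have B : 1 - M%:R * (1 - s) <= s ^+ M.
  by apply: bernoulli_le1; rewrite !ltW.
have D := down M Mn.
(* Origin of the 4: the choice of [M] and [down] give [S * s ^+ M <= 2 * a], Bernoulli gives
   [S - 2 * a * s <= S * s ^+ M], and [s <= 1]. *)
have : S * s ^+ M <= 2 * a.
  apply: le_trans (_ : 2 * G (n - M)%N * s ^+ M <= _).
    by rewrite ler_wpM2r ?exprn_ge0// ltW.
  by rewrite -mulrA ler_pM2l.
have : S * (1 - M%:R * (1 - s)) <= S * s ^+ M by rewrite ler_pM2l.
have : a * s <= a by rewrite ger_pMr// ltW.
by lra.
Qed.

End LogConcave.

(** * Tail sums, and a power series parameter with prescribed mean *)

Section Series.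
Variable R : realType.
Implicit Types (f p h : R^nat).

Lemma is_cvg_series_shiftS (u : R^nat) :
  cvgn (series u) -> cvgn (series (fun n => u n.+1)).
Proof.
move=> cu.
rewrite (_ : series _ = (fun n => series u n.+1 - u 0%N)).
  apply: is_cvgB; last exact: is_cvg_cst.
  by apply/cvg_ex; exists (limn (series u)); rewrite (cvg_shiftS (series u)).
by apply/funext => n; rewrite /series/= big_nat_recl//= addrC addKr.
Qed.

(** For [y] strictly between the two radii, the factorization of [y ^+ n.+1 - |z| ^+ n.+1] bounds
    [n.+1 * |z| ^+ n] by [y ^+ n.+1 / (y - |z|)], and the series converges absolutely at [y]. *)
Lemma is_cvg_pseries_diffs f (x z : R) : cvgn (pseries f x) -> `|z| < `|x| ->
  cvgn (pseries (pseries_diffs f) z).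
Proof.
move=> fx zx; apply: normed_cvg.
pose y : R := (`|z| + `|x|) / 2.
have z0 := normr_ge0 z.
have zy : `|z| < y by rewrite /y; lra.
have yx : `|y| < `|x| by rewrite ger0_norm /y; lra.
have y0 : 0 <= y by exact: le_trans (ltW zy).
have cy := is_cvg_pseries_inside_norm fx yx.
pose v : R^nat := (y - `|z|)^-1 *: (fun n => `|f n.+1| * y ^+ n.+1).
apply: (@series_le_cvg _ _ v).
- by move=> n /=.
- move=> n; rewrite /v/=; apply: mulr_ge0; rewrite ?invr_ge0 ?subr_ge0 ?(ltW zy)//.
  by rewrite mulr_ge0// exprn_ge0.
- move=> n; rewrite /v/= /pseries_diffs.
  rewrite [leRHS]mulrC ler_pdivlMr ?subr_gt0// !normrM normrX normr_nat.
  rewrite [_ * `|f n.+1|]mulrC -!mulrA ler_wpM2l//.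
  apply: (@le_trans _ _ (y ^+ n.+1 - `|z| ^+ n.+1)); last first.
    by rewrite gerBl exprn_ge0.
  rewrite subrXX mulrA mulrC ler_pM2l ?subr_gt0//.
  rewrite mulr_natl -[X in _ *+ X]card_ord -sumr_const.
  apply: ler_sum => i _ /=.
  have -> : `|z| ^+ n = `|z| ^+ (n - i) * `|z| ^+ i.
    by rewrite -exprD subnK// -ltnS.
  by rewrite ler_wpM2r ?exprn_ge0// lerXn2r ?nnegrE// ltW.
- exact: is_cvg_seriesZ (is_cvg_series_shiftS cy).
Qed.

Lemma nondecreasing_nneg_series p : (forall n, 0 <= p n) ->
  {homo series p : n m / (n <= m)%N >-> n <= m}.
Proof. by move=> p0; apply: nondecreasing_series => n _ _; exact: p0. Qed.

(** Summing [p j * p i.+1 <= p j.+1 * p i] over [i > j] gives [key]. Expanding [G j] and one factor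
    [G j.+1] by [GS] reduces the claim to it. *)
Lemma log_concave_tail p : (forall n, 0 < p n) -> log_concave p ->
  cvgn (series p) -> log_concave (fun j => limn (series p) - series p j).
Proof.
move=> p0 lcp cp j.
pose G j := limn (series p) - series p j.
rewrite -/(G _) -/(G _) -/(G _).
have homo := nondecreasing_nneg_series (fun n => ltW (p0 n)).
have GS i : G i = p i + G i.+1 by rewrite /G seriesSr; lra.
have key : p j * G j.+2 <= p j.+1 * G j.+1.
  rewrite /G [X in X <= _]mulrBr lerBlDr.
  have -> : p j * limn (series p) = limn (fun n => p j * series p n).
    by apply/esym/cvg_lim => //; exact: cvgMl_tmp.
  apply: limr_le; first by apply: is_cvgMl_tmp.
  exists j.+2 => // m /= /subnK <-; rewrite addnC.
  rewrite -lerBlDr -mulrBr; set d := (m - j.+2)%N.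
  apply: (@le_trans _ _ (p j.+1 * (series p (j.+1 + d)%N - series p j.+1))).
    elim: d => [|d IH]; first by rewrite !addn0 !subrr !mulr0.
    have := @log_concave_ratio _ p j (j.+1 + d)%N p0 lcp ltac:(lia).
    rewrite -[(j.+1 + d).+1]/(j.+2 + d)%N !addnS; move: IH.
    have := seriesSr p (j.+1 + d); have := seriesSr p (j.+2 + d).
    by move=> -> ->; lra.
  rewrite ler_pM2l// lerD2r; exact: nondecreasing_cvgn_le.
by rewrite expr2 {1}(GS j) {3}(GS j.+1); move: key; lra.
Qed.

Lemma log_concave_mean_tail p n : (forall i, 0 < p i) -> log_concave p ->
  cvgn (series p) ->
  series (fun i => i%:R * p i) @ \oo --> n%:R * limn (series p) ->
  limn (series p) <= 4 * (limn (series p) - series p n).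
Proof.
move=> p0 lcp cp mean.
have homo := nondecreasing_nneg_series (fun n => ltW (p0 n)).
pose G j := limn (series p) - series p j.
have e0 : limn (series p) = G 0%N by rewrite /G /series/= big_nil subr0.
have GS i : G i = p i + G i.+1 by rewrite /G seriesSr; lra.
have G0 j : 0 < G j.
  have := nondecreasing_cvgn_le homo cp j.+1; have := p0 j.
  by rewrite /G seriesSr; lra.
rewrite {1}e0 -/(G n); apply: log_concave_tail_mean => //.
- exact: log_concave_tail.
- by move=> j; rewrite [ltRHS]GS ltrDr.
- move=> e e_gt0.
  have : \forall N \near \oo, n%:R * G 0%N - e < series (fun i => i%:R * p i) N.
    by move: mean; rewrite e0 => /cvgr_gt; apply; rewrite ltrBlDr ltrDl.
  move=> [N0 _ /(_ N0.+1 (leqnSn _)) hN]; exists N0.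
  apply: lt_le_trans hN _.
  (* Summation by parts: the mean is the sum of the tails, and the boundary term has the favourable
     sign. *)
  have -> : series (fun i => i%:R * p i) N0.+1 =
     \sum_(j < N0) G j.+1 - N0%:R * G N0.+1.
    elim: N0 => [|N IH].
      by rewrite seriesSr /series/= big_nil big_ord0; lra.
    by rewrite seriesSr IH big_ord_recr/= [G N.+1]GS -natr1; ring.
  by rewrite gerBl mulr_ge0// ltW.
Qed.

(* At [z = n / (n + 1) / q] the sequence [h i / q ^+ i] is nondecreasing, so
   [\sum_i (i - n) * h i * z ^+ i] is at least its value for [h i = q ^+ i],
   which is [0]; at [z = 0] it is negative. *)
Lemma pseries_mean_exists h (q : R) n : (0 < n)%N -> 0 < q ->
  (forall i, 0 < h i) -> (forall i, q * h i <= h i.+1) ->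
  (forall z, 0 < z -> z * q < 1 -> cvgn (pseries h z)) ->
  exists z, [/\ 0 < z, z * q < 1 &
    series (fun i => i%:R * (h i * z ^+ i)) @ \oo --> n%:R * limn (pseries h z)].
Proof.
move=> n0 q0 h0 hq hcv.
have nR : 0 < n%:R :> R by rewrite ltr0n.
pose w : R := n%:R / n.+1%:R.
have w0 : 0 < w by rewrite divr_gt0.
have w1 : w < 1 by rewrite ltr_pdivrMr// mul1r ltr_nat.
pose b := w / q.
have b0 : 0 < b by rewrite divr_gt0.
have bq : b * q = w by rewrite /b divfK// gt_eqF.
(* The points [b < c < d < e < g] all lie below [q^-1]. Each formal derivative costs a little
   radius, and differentiating [D] calls for the third derivative series to converge at [c]. *)
pose c : R := (w + 1) / 2 / q.
have cq : c * q = (w + 1) / 2 by rewrite /c divfK// gt_eqF.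
pose d : R := (w + 3) / 4 / q.
have dq : d * q = (w + 3) / 4 by rewrite /d divfK// gt_eqF.
have bc : b < c by rewrite -(ltr_pM2r q0) bq cq; lra.
have cd : c < d by rewrite -(ltr_pM2r q0) dq cq; lra.
pose e : R := (w + 7) / 8 / q.
have eq : e * q = (w + 7) / 8 by rewrite /e divfK// gt_eqF.
have de : d < e by rewrite -(ltr_pM2r q0) dq eq; lra.
pose g : R := (w + 15) / 16 / q.
have gq : g * q = (w + 15) / 16 by rewrite /g divfK// gt_eqF.
have eg : e < g by rewrite -(ltr_pM2r q0) gq eq; lra.
have Cg : cvgn (pseries h g) by apply: hcv; rewrite ?gq; lra.
have nrm (u v : R) : 0 <= u -> u < v -> `|u| < `|v|.
  by move=> u0 uv; rewrite !ger0_norm//; lra.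
have Ce : cvgn (pseries (pseries_diffs h) e).
  by apply: is_cvg_pseries_diffs Cg _; apply: nrm; lra.
have Cd : cvgn (pseries (pseries_diffs (pseries_diffs h)) d).
  by apply: is_cvg_pseries_diffs Ce _; apply: nrm; lra.
have Cc : cvgn (pseries (pseries_diffs (pseries_diffs (pseries_diffs h))) c).
  by apply: is_cvg_pseries_diffs Cd _; apply: nrm; lra.
have inside f (u v : R) : cvgn (pseries f v) -> 0 <= u -> u < v ->
    cvgn (pseries f u).
  by move=> cv u0 uv; apply: is_cvg_pseries_inside cv _; exact: nrm.
pose F z := limn (pseries h z).
pose D z := limn (pseries (pseries_diffs h) z).
have dF z : 0 <= z -> z < c -> derivable F z 1.
  move=> z0 zc; have /= [] := @pseries_snd_diffs _ h c z _ _ _ _ => //.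
  - by apply: inside Cg _ _; lra.
  - by apply: inside Ce _ _; lra.
  - by apply: inside Cd _ _; lra.
  - exact: nrm.
have dD z : 0 <= z -> z < c -> derivable D z 1.
  move=> z0 zc; have /= [] := @pseries_snd_diffs _ (pseries_diffs h) c z _ _ _ _ => //.
  - by apply: inside Ce _ _; lra.
  - by apply: inside Cd _ _; lra.
  - exact: nrm.
have mean z : 0 <= z -> z < c ->
    series (fun i => i%:R * (h i * z ^+ i)) @ \oo --> z * D z.
  move=> z0 zc; have Dz : cvgn (pseries (pseries_diffs h) z).
    by apply: inside Ce _ _; lra.
  rewrite (_ : series _ =
      (fun N => z * series (fun i => i%:R * h i * z ^+ i.-1) N)).
    exact: cvgMl_tmp (pseries_diffs_equiv Dz).
  apply/funext => N; rewrite /series/= mulr_sumr.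
  apply: eq_bigr => -[|i] _; first by rewrite !mul0r mulr0.
  by rewrite exprS/=; ring.
pose phi z := z * D z - n%:R * F z.
have phib : 0 <= phi b.
  have hb : (fun N => series (fun i => i%:R * (h i * b ^+ i)) N -
     n%:R * pseries h b N) @ \oo --> phi b.
    apply: cvgB; first by apply: mean; lra.
    by apply: cvgMl_tmp; apply: inside Cg _ _; lra.
  pose k := h n / q ^+ n.
  have k0 : 0 < k by rewrite divr_gt0 ?exprn_gt0.
  (* The closed form of the partial sums in the comparison case: [w] is the parameter of the
     geometric law with mean [n]. *)
  have geo : (fun N : nat => - (k * n.+1%:R) * (N%:R * w ^+ N)) @ \oo --> 0.
    rewrite -[X in _ --> X](mulr0 (- (k * n.+1%:R))); apply: cvgMl_tmp.
    have wv : w < (w + 1) / 2 by lra.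
    have v1 : `|(w + 1) / 2| < 1 by rewrite ger0_norm; lra.
    have cv1 : cvgn (pseries (fun=> 1) ((w + 1) / 2)).
      rewrite /pseries (_ : (fun i => _) = geometric 1 ((w + 1) / 2)).
        exact: is_cvg_geometric_series.
      by apply/funext => i; rewrite /= mul1r.
    have := is_cvg_pseries_diffs cv1 (nrm _ _ (ltW w0) wv).
    move=> /is_cvg_pseries_diffs_equiv/cvg_series_cvg_0 cv0.
    rewrite (_ : (fun N : nat => N%:R * w ^+ N) =
       (fun N => w * (N%:R * 1 * w ^+ N.-1))).
      by rewrite -[X in _ --> X](mulr0 w); exact: cvgMl_tmp.
    apply/funext => -[|N]; first by rewrite !mul0r mulr0.
    by rewrite /= exprS mulr1; ring.
  apply: (ler_cvg_to geo hb); apply: nearW => N.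
  rewrite /= /pseries /series/= mulr_sumr -sumrB.
  have -> : - (k * n.+1%:R) * (N%:R * w ^+ N) =
      \sum_(0 <= i < N) k * ((i%:R - n%:R) * w ^+ i).
    elim: N => [|N IH]; first by rewrite big_nil mul0r mulr0.
    have ew : n%:R = w * n.+1%:R by rewrite divfK// pnatr_eq0.
    rewrite big_nat_recr//= -IH exprSr.
    transitivity (- k * N.+1%:R * w ^+ N * (w * n.+1%:R)); first by ring.
    by rewrite -ew -(natr1 N) -(natr1 n); ring.
  apply: ler_sum => i _.
  pose u i := h i / q ^+ i.
  have uS j : u j <= u j.+1.
    rewrite /u exprS invfM mulrA ler_pM2r ?invr_gt0 ?exprn_gt0//.
    by rewrite ler_pdivlMr// mulrC.
  have umono : {homo u : i j / (i <= j)%N >-> i <= j} by exact/nondecreasing_seqP.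
  have -> : i%:R * (h i * b ^+ i) - n%:R * (h i * b ^+ i) =
            u i * ((i%:R - n%:R) * w ^+ i).
    have qi : q ^+ i != 0 by rewrite expf_neq0// gt_eqF.
    have -> : w ^+ i = b ^+ i * q ^+ i by rewrite -exprMn bq.
    by rewrite /u; field.
  (* [u i - u n] and [i - n] have the same sign, so [u i] may be replaced by [u n = k]. *)
  have [ni|ni] := leqP n i.
    apply: ler_wpM2r; last exact: umono.
    by rewrite mulr_ge0 ?exprn_ge0 ?subr_ge0 ?ler_nat// ltW.
  apply: ler_wnM2r; last exact/umono/ltnW.
  by rewrite mulr_le0_ge0 ?exprn_ge0 ?subr_le0 ?ler_nat ?(ltnW ni) ?(ltW w0).
have phi0 : phi 0 < 0.
  rewrite /phi mul0r sub0r oppr_lt0 mulr_gt0// /F.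
  rewrite (_ : limn _ = h 0%N)//; apply: cvg_lim => //.
  apply: cvg_near_cst; exists 1%N => // -[|N] //= _.
  rewrite /pseries /series/= big_nat_recl//= mulr1 big1 ?addr0// => i _.
  by rewrite expr0n mulr0.
have phic : {within `[0, b], continuous phi}.
  apply: continuous_in_subspaceT => z /set_mem/=.
  rewrite in_itv/= => /andP[z0 zb].
  have zc : z < c by exact: le_lt_trans bc.
  have cD : {for z, continuous D}.
    exact/differentiable_continuous/derivable1_diffP/dD.
  have cF : {for z, continuous F}.
    exact/differentiable_continuous/derivable1_diffP/dF.
  apply: cvgB; last exact: cvgMl_tmp cF.
  by apply: cvgM; [exact: cvg_id|exact: cD].
have [|z] := @IVT _ phi 0 b 0 (ltW b0) phic.
  by rewrite ge_min le_max phib (ltW phi0) orbT.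
rewrite in_itv/= => /andP[z0 zb] phiz; exists z; split.
- rewrite lt_neqAle z0 andbT; apply/eqP => ze.
  have : phi z < 0 by rewrite -ze.
  by rewrite phiz ltxx.
- by apply: le_lt_trans w1; rewrite -bq ler_pM2r.
- move: phiz => /subr0_eq <-; apply: mean; lra.
Qed.

End Series.

(** * Multisets of levels and complete homogeneous symmetric functions *)

Section Multisets.
Variable R : realType.

Lemma esumZl (T : choiceType) (I : set T) (a : T -> \bar R) (c : R) : 0 < c ->
  (forall i, 0 <= a i)%E ->
  (\esum_(i in I) (c%:E * a i) = c%:E * \esum_(i in I) a i)%E.
Proof.
move=> c0 a0; rewrite /esum -ereal_sup_pZl//; congr ereal_sup.
apply/seteqP; split.
  move=> _ [A IA <-]; exists (\sum_(i \in A) a i)%E; first by exists A.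
  exact: ge0_mule_fsumr.
by move=> _ [_ [A IA <-] <-]; exists A => //; rewrite ge0_mule_fsumr.
Qed.

(* Multisets of [n] indices satisfying [a], as sorted tuples. *)
Definition multiset (a : pred nat) n : set (n.-tuple nat) :=
  [set t | sorted leq t /\ all a t].
Arguments multiset a n : clear implicits.

Definition mset_insert k n (t : n.-tuple nat) : n.+1.-tuple nat :=
  [tuple of sort leq (k :: t)].

Lemma mset_insert_bij (a : pred nat) k n : a k ->
  set_bij (multiset a n) (multiset a n.+1 `&` [set t | k \in (t : seq nat)])
    (@mset_insert k n).
Proof.
move=> ak; split.
- move=> t [st at_]; split; [split|].
  + exact: (sort_sorted leq_total).
  + by rewrite /= all_sort /= ak.
  + by rewrite /= mem_sort mem_head.
- move=> t t' /set_mem[st _] /set_mem[st' _] /(congr1 val)/= e.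
  apply/val_inj/(sorted_eq leq_trans anti_leq st st').
  by rewrite -(perm_cons k) -(perm_sort leq (k :: t)) e perm_sort.
- move=> t [[st at_] kt].
  have sz : size (rem k t) == n by rewrite size_rem// size_tuple.
  exists (Tuple sz); first split => /=.
  + exact: (subseq_sorted leq_trans (rem_subseq _ _)).
  + by apply/allP => y /mem_rem; exact/allP.
  + apply/val_inj/(sorted_eq leq_trans anti_leq) => //=.
      exact: (sort_sorted leq_total).
    by rewrite perm_sort perm_sym perm_to_rem.
Qed.

Variable x : nat -> R.
Hypothesis x_gt0 : forall l, 0 < x l.

Definition mset_weight n (t : n.-tuple nat) : R := \prod_(l <- t) x l.

Lemma mset_weight_gt0 n (t : n.-tuple nat) : 0 < mset_weight t.
Proof. by apply: prodr_gt0 => l _. Qed.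

(** Taking one copy of [k] out of a multiset. Constant [phi] serves the partition function, the
    identity serves the occupation number. *)
Lemma esum_mset_insert (a : pred nat) k n (phi : nat -> R) :
  (forall i, 0 <= phi i) -> a k ->
  (\esum_(t in multiset a n.+1 `&` [set t | k \in (t : seq nat)])
     (phi (count_mem k t) * mset_weight t)%:E =
   (x k)%:E *
   \esum_(t in multiset a n) (phi (count_mem k t).+1 * mset_weight t)%:E)%E.
Proof.
move=> phi0 ak; rewrite (reindex_esum _ _ _ _ (mset_insert_bij n ak)) -esumZl//.
2: by move=> t; rewrite lee_fin mulr_ge0// ltW// mset_weight_gt0.
apply: eq_esum => t _; rewrite -EFinM; congr EFin.
have pe : perm_eq (mset_insert k t) (k :: t) by rewrite /= perm_sort.
rewrite (seq.permP pe) /mset_weight (perm_big _ pe)/= eqxx big_cons add1n.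
by rewrite mulrCA.
Qed.

Lemma esum_mset_insert1 (a : pred nat) k n : a k ->
  (\esum_(t in multiset a n.+1 `&` [set t | k \in (t : seq nat)])
     (mset_weight t)%:E =
   (x k)%:E * \esum_(t in multiset a n) (mset_weight t)%:E)%E.
Proof.
move=> ak; transitivity
  (\esum_(t in multiset a n.+1 `&` [set t | k \in (t : seq nat)])
     (1 * mset_weight t)%:E)%E.
  by apply: eq_esum => t _; rewrite mul1r.
rewrite (@esum_mset_insert _ k n (fun=> 1))//; congr (_ * _)%E.
by apply: eq_esum => t _; rewrite mul1r.
Qed.

Fixpoint geometric_conv (u : nat -> R) (y : R) n : R :=
  if n is m.+1 then u n + y * geometric_conv u y m else u 0%N.

(* [hpoly L n] is the complete homogeneous symmetric polynomial of degree [n] in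
   [x 1, ..., x L]. *)
Fixpoint hpoly L : nat -> R :=
  if L is M.+1 then geometric_conv (hpoly M) (x L) else fun n => (n == 0%N)%:R.

Lemma hpoly0 L : hpoly L 0%N = 1.
Proof. by elim: L => //= L ->. Qed.

Lemma hpolyS L n : hpoly L.+1 n.+1 = hpoly L n.+1 + x L.+1 * hpoly L.+1 n.
Proof. by []. Qed.

Arguments hpoly : simpl never.

Lemma esum_mset0 (a : pred nat) :
  (\esum_(t in multiset a 0) (mset_weight t)%:E = 1)%E.
Proof.
rewrite (_ : multiset _ _ = [set [tuple]]) ?esum_set1.
- by rewrite /mset_weight big_nil.
- by rewrite lee_fin ltW// mset_weight_gt0.
- by apply/seteqP; split => t /=; rewrite [t]tuple0.
Qed.

(** A multiset either avoids level [L.+1] or loses one copy of it; these are the two terms of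
    [hpolyS]. *)
Lemma esum_mset_hsum L n :
  (\esum_(t in multiset (fun l => 0 < l <= L)%N n) (mset_weight t)%:E =
   (hpoly L n)%:E)%E.
Proof.
elim: L n => [|L IHL] n.
  case: n => [|n]; first exact: esum_mset0.
  rewrite (_ : multiset _ _ = set0) ?esum_set0//.
  apply/seteqP; split => // t [_].
  by case/tupleP: t => -[|y] t.
elim: n => [|n IHn]; first by rewrite esum_mset0 hpoly0.
have w0 m (t : m.-tuple nat) : (0 <= (mset_weight t)%:E)%E.
  by rewrite lee_fin ltW// mset_weight_gt0.
rewrite (esumID [set t : n.+1.-tuple nat | L.+1 \in (t : seq nat)])//.
rewrite addeC hpolyS EFinD EFinM; congr (_ + _)%E; last first.
  by rewrite -IHn; apply: esum_mset_insert1; rewrite ltnS leqnn.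
rewrite -IHL; congr esum; apply/seteqP; split => t /=.
  move=> [[st /allP at_] Lt]; split => //; apply/allP => l lt.
  have /andP[-> /=] := at_ _ lt.
  by rewrite leq_eqVlt => /orP[/eqP lL|//]; case: Lt; rewrite -lL.
move=> [st /allP at_]; split; first split => //.
  by apply/allP => l /at_ /andP[-> /leqW].
by move=> /at_; rewrite ltnn andbF.
Qed.

Lemma hpoly_ge0 L n : 0 <= hpoly L n.
Proof.
rewrite -lee_fin -esum_mset_hsum; apply: esum_ge0 => t _.
by rewrite lee_fin ltW// mset_weight_gt0.
Qed.

Lemma hpoly_homo n : {homo hpoly^~ n : L M / (L <= M)%N >-> L <= M}.
Proof.
apply/nondecreasing_seqP => L; case: n => [|n]; first by rewrite !hpoly0.
by rewrite hpolyS lerDl mulr_ge0 ?hpoly_ge0// ltW.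
Qed.

Lemma hpoly1 n : hpoly 1 n = x 1%N ^+ n.
Proof. by elim: n => // n IH; rewrite hpolyS IH add0r exprS. Qed.

Lemma hpoly_gt0 L n : 0 < hpoly L.+1 n.
Proof. by apply: lt_le_trans (hpoly_homo _ (ltn0Sn L)); rewrite hpoly1 exprn_gt0. Qed.

(** The induction starts at one level because [hpoly 0] vanishes in positive degree, whereas the
    convolution lemma wants positive terms. *)
Lemma log_concave_hsum L : log_concave (hpoly L.+1).
Proof.
elim: L => [n|L IH].
  by rewrite !hpoly1 -exprD -exprM (_ : n + n.+2 = n.+1 * 2)%N//; lia.
by apply: (log_concave_geometric_conv (hpoly_gt0 L) IH (x_gt0 L.+2)).
Qed.

Variable s : R.
Hypothesis x_le : forall l, (0 < l)%N -> x l <= x 1%N.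
Hypothesis x_sum : forall L, \sum_(l < L) x l.+1 <= s.

(* The generating function of [hpoly L] is [\prod_(l <= L) (1 - z * x l)^-1],
   and [(1 - y)^-1 <= expR (y / (1 - y))]. *)
Lemma hpoly_pseries_le L N z : 0 < z -> z * x 1%N < 1 ->
  \sum_(n < N) hpoly L n * z ^+ n <= expR (z / (1 - z * x 1%N) * s).
Proof.
move=> z0 zx; set c := z / _.
have c0 : 0 < c by rewrite divr_gt0// subr_gt0.
suff : \sum_(n < N) hpoly L n * z ^+ n <= expR (c * \sum_(l < L) x l.+1).
  by move/le_trans; apply; rewrite ler_expR ler_pM2l.
elim: L => [|L IH].
  rewrite big_ord0 mulr0 expR0; case: N => [|N]; first by rewrite big_ord0.
  rewrite big_ord_recl/= mulr1 big1 ?addr0// => i _.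
  by rewrite mul0r.
rewrite [X in expR (c * X)]big_ord_recr mulrDr expRD.
set y := z * x L.+1.
have y0 : 0 < y by rewrite mulr_gt0.
have yx : y <= z * x 1%N by rewrite ler_pM2l// x_le.
have y1 : 0 < 1 - y by lra.
set S := \sum_(n < N) _.
have SE M : \sum_(n < M.+1) hpoly L.+1 n * z ^+ n =
    \sum_(n < M.+1) hpoly L n * z ^+ n + y * \sum_(n < M) hpoly L.+1 n * z ^+ n.
  elim: M => [|M IHM].
    by rewrite !big_ord_recr !big_ord0 !hpoly0 mulr0 addr0.
  rewrite big_ord_recr/= {1}IHM hpolyS [in RHS]big_ord_recr/=.
  rewrite (_ : \sum_(n < M.+1) hpoly L.+1 n * z ^+ n =
    \sum_(n < M) hpoly L.+1 n * z ^+ n + hpoly L.+1 M * z ^+ M).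
    by rewrite exprS /y; ring.
  by rewrite big_ord_recr.
(* Truncation turns the product formula into an inequality: the shifted sum has one nonnegative term
   less than [S]. *)
have SS : S <= \sum_(n < N) hpoly L n * z ^+ n + y * S.
  rewrite /S; case: N {IH S} => [|N]; first by rewrite !big_ord0 mulr0 addr0.
  rewrite {1}SE lerD2l ler_pM2l// [leRHS]big_ord_recr lerDl.
  by rewrite mulr_ge0 ?hpoly_ge0// exprn_ge0// ltW.
have : S * (1 - y) <= expR (c * \sum_(l < L) x l.+1) by move: SS IH; lra.
rewrite -ler_pdivlMr// => /le_trans; apply.
rewrite ler_pM2l ?expR_gt0//.
apply: le_trans (expR_ge1Dx _).
apply: (@le_trans _ _ (1 + y / (1 - y))).
  by rewrite le_eqVlt; apply/orP; left; apply/eqP; field; rewrite gt_eqF.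
rewrite lerD2l /c [leRHS]mulrAC -/y ler_pM2l// lef_pV2 ?posrE//; lra.
Qed.

Definition mset_sum n : R :=
  fine (\esum_(t in multiset (fun l => 0 < l)%N n) (mset_weight t)%:E).

Definition mset_occ k n : R :=
  fine (\esum_(t in multiset (fun l => 0 < l)%N n)
          ((count_mem k t)%:R * mset_weight t)%:E).

(** One term of the generating sum is at most the whole, whose bound does not involve [L]; [z] is
    half the critical value [(x 1)^-1]. *)
Lemma hpoly_bounded n : exists C, forall L, hpoly L n <= C.
Proof.
pose z := (2 * x 1%N)^-1.
have z0 : 0 < z by rewrite invr_gt0 mulr_gt0.
have zx : z * x 1%N = 2^-1 by rewrite /z; field; rewrite gt_eqF.
exists (expR (z / (1 - z * x 1%N) * s) / z ^+ n) => L.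
rewrite ler_pdivlMr ?exprn_gt0//.
apply: le_trans (hpoly_pseries_le L n.+1 z0 _); last by rewrite zx; lra.
rewrite big_ord_recr/= lerDr sumr_ge0// => i _.
by rewrite mulr_ge0 ?hpoly_ge0// exprn_ge0// ltW.
Qed.

(** A finite set of multisets meets only finitely many levels, so the full sum is the increasing
    limit of the [hpoly L n]. *)
Lemma mset_sumE n :
  (\esum_(t in multiset (fun l => 0 < l)%N n) (mset_weight t)%:E =
   (mset_sum n)%:E)%E /\ hpoly^~ n @ \oo --> mset_sum n.
Proof.
have [C hC] := hpoly_bounded n.
have cv : cvgn (hpoly^~ n).
  apply: nondecreasing_is_cvgn; first exact: hpoly_homo.
  by exists C => _ [L _ <-].
suff e : (\esum_(t in multiset (fun l => 0 < l)%N n) (mset_weight t)%:E =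
   (limn (hpoly^~ n))%:E)%E.
  by rewrite /mset_sum e/=; split.
apply/eqP; rewrite eq_le; apply/andP; split.
  apply: ge_ereal_sup => _ [A [finA AI] <-].
  have [L AL] : exists L, A `<=` multiset (fun l => 0 < l <= L)%N n.
    have /finite_seqP[r rA] := finA.
    exists (\max_(t <- r) \max_(l <- (t : seq nat)) l)%N => t At.
    have [st /allP at_] := AI _ At; split => //; apply/allP => l lt.
    rewrite at_//=.
    apply: (@leq_trans (\max_(l <- (t : seq nat)) l)%N).
      exact: (@leq_bigmax_seq _ _ predT id).
    apply: (@leq_bigmax_seq _ _ predT
      (fun t : n.-tuple nat => \max_(l <- (t : seq nat)) l)%N) => //.
    by move: At; rewrite rA.
  apply: (@le_trans _ _ (hpoly L n)%:E).
    by rewrite -esum_mset_hsum; apply: ereal_sup_ubound; exists A.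
  rewrite lee_fin; apply: nondecreasing_cvgn_le cv _; exact: hpoly_homo.
rewrite -EFin_lim//; apply: lime_le.
  by apply/cvg_ex; exists (limn (hpoly^~ n))%:E; apply: cvg_EFin => //; exact: nearW.
apply: nearW => L /=; rewrite -esum_mset_hsum.
apply: le_ereal_sup => _ [A [finA AI] <-]; exists A => //; split => // t /AI[st].
by move=> /allP at_; split => //; apply/allP => l /at_/andP[].
Qed.

Lemma mset_sum_gt0 n : 0 < mset_sum n.
Proof.
apply: lt_le_trans (hpoly_gt0 0 n) _; have [_ cv] := mset_sumE n.
rewrite -(cvg_lim _ cv)//; apply: (nondecreasing_cvgn_le (hpoly_homo n)).
by apply/cvg_ex; exists (mset_sum n).
Qed.

Lemma log_concave_mset_sum : log_concave mset_sum.
Proof.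
move=> n; have cv m := (mset_sumE m).2.
apply: (ler_cvg_to (cvgM (cv n) (cv n.+2)) (cvgM (cv n.+1) (cv n.+1))).
by exists 1%N => // -[|L] // _; exact: log_concave_hsum.
Qed.

(** Inserting a particle in the lowest level is injective. This is the growth hypothesis of
    [pseries_mean_exists]. *)
Lemma mset_sum_ratio n : x 1%N * mset_sum n <= mset_sum n.+1.
Proof.
rewrite -lee_fin EFinM -!(mset_sumE _).1 -esum_mset_insert1//.
by apply: le_ereal_sup => _ [A [finA AI] <-]; exists A => //; split => // t /AI[].
Qed.

Lemma is_cvg_mset_sum_pseries z : 0 < z -> z * x 1%N < 1 ->
  cvgn (pseries mset_sum z).
Proof.
move=> z0 zx; apply: nondecreasing_is_cvgn.
  apply: nondecreasing_nneg_series => n.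
  by rewrite mulr_ge0 ?exprn_ge0 ?(ltW (mset_sum_gt0 _))// ltW.
exists (expR (z / (1 - z * x 1%N) * s)) => _ [N _ <-].
rewrite /pseries /series/=.
have cv : (fun L => \sum_(0 <= n < N) hpoly L n * z ^+ n) @ \oo -->
    \sum_(0 <= n < N) mset_sum n * z ^+ n.
  apply: cvg_big => [|n _]; first exact: add_continuous.
  by apply: cvgMr_tmp; exact: (mset_sumE n).2.
rewrite -(cvg_lim _ cv)//; apply: limr_le.
  by apply/cvg_ex; eexists; exact: cv.
by apply: nearW => L; rewrite big_mkord; exact: hpoly_pseries_le.
Qed.

(** Makes the sum finite, so that [fine] in [mset_occ] loses nothing. The factor [n.+1] stays
    positive at [n = 0], as [esumZl] demands. *)
Lemma esum_mset_occ_le k n :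
  (\esum_(t in multiset (fun l => 0 < l)%N n)
     ((count_mem k t)%:R * mset_weight t)%:E <= (n.+1%:R * mset_sum n)%:E)%E.
Proof.
rewrite EFinM -(mset_sumE n).1 -esumZl//; last first.
  by move=> t; rewrite lee_fin ltW// mset_weight_gt0.
apply: le_esum => t _; rewrite -EFinM lee_fin ler_pM2r ?mset_weight_gt0//.
by rewrite ler_nat leqW// -[X in (_ <= X)%N](size_tuple t) count_size.
Qed.

Lemma mset_occE k n :
  (\esum_(t in multiset (fun l => 0 < l)%N n)
     ((count_mem k t)%:R * mset_weight t)%:E = (mset_occ k n)%:E)%E.
Proof.
rewrite /mset_occ fineK// ge0_fin_numE.
  exact: le_lt_trans (esum_mset_occ_le k n) (ltry _).
by apply: esum_ge0 => t _; rewrite lee_fin mulr_ge0// ltW// mset_weight_gt0.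
Qed.

Lemma mset_occ_le k n : mset_occ k n <= n.+1%:R * mset_sum n.
Proof. by rewrite -lee_fin -mset_occE; exact: esum_mset_occ_le. Qed.

Lemma mset_occ_ge0 k n : 0 <= mset_occ k n.
Proof.
rewrite -lee_fin -mset_occE; apply: esum_ge0 => t _.
by rewrite lee_fin mulr_ge0// ltW// mset_weight_gt0.
Qed.

Lemma mset_occ0 k : mset_occ k 0 = 0.
Proof. by rewrite /mset_occ esum1// => t _; rewrite [t]tuple0 /= mul0r. Qed.

(** Only multisets containing [k] contribute; removing one copy leaves a count plus one, and that
    one produces [mset_sum n]. *)
Lemma mset_occS k n : (0 < k)%N ->
  mset_occ k n.+1 = x k * (mset_sum n + mset_occ k n).
Proof.
move=> k0; apply: EFin_inj; rewrite EFinM EFinD -(mset_sumE n).1 -!mset_occE.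
have w0 m (t : m.-tuple nat) : (0 <= (mset_weight t)%:E)%E.
  by rewrite lee_fin ltW// mset_weight_gt0.
have c0 m (t : m.-tuple nat) : (0 <= ((count_mem k t)%:R * mset_weight t)%:E)%E.
  by rewrite lee_fin mulr_ge0// ltW// mset_weight_gt0.
rewrite (esumID [set t : n.+1.-tuple nat | k \in (t : seq nat)])//.
rewrite [X in (_ + X)%E]esum1 ?adde0; last first.
  by move=> t [_ /= /negP/count_memPn ->]; rewrite mul0r.
rewrite (@esum_mset_insert _ k n (fun i => i%:R))//; congr (_ * _)%E.
rewrite -esumD//; apply: eq_esum => t _.
by rewrite -EFinD -natr1 mulrDl mul1r addrC.
Qed.

End Multisets.

(** * Growth of the Dirichlet eigenvalues and summability of the Boltzmann factors *)

Section Spectrum.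
Variables (R : realType) (a1 a2 a3 V : R).
Hypothesis V_gt0 : 0 < V.

Let levels k := [set lam : R | exists f : 'I_k -> nat * nat * nat,
  injective f /\ forall i, Eone R a1 a2 a3 V (f i) <= lam].

Lemma Eone_le_sqrt : exists2 c, 0 < c & forall m lam, Eone R a1 a2 a3 V m <= lam ->
  [/\ m.1.1.+1%:R <= Num.sqrt (lam / c), m.1.2.+1%:R <= Num.sqrt (lam / c) &
      m.2.+1%:R <= Num.sqrt (lam / c)].
Proof.
pose A := (V `^ a1) ^+ 2; pose B := (V `^ a2) ^+ 2; pose C := (V `^ a3) ^+ 2.
have A0 : 0 < A by rewrite exprn_gt0 ?powR_gt0.
have B0 : 0 < B by rewrite exprn_gt0 ?powR_gt0.
have C0 : 0 < C by rewrite exprn_gt0 ?powR_gt0.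
have p0 : 0 < pi ^+ 2 / 2 :> R by rewrite divr_gt0// exprn_gt0// pi_gt0.
have ABC : 0 < A + B + C by lra.
have c0 : 0 < pi ^+ 2 / 2 / (A + B + C) by rewrite divr_gt0.
(* [A + B + C] dominates each of the three denominators, so one constant serves all directions. *)
exists (pi ^+ 2 / 2 / (A + B + C)) => //.
move=> [[m1 m2] m3] lam; rewrite /Eone/= -/A -/B -/C => Elam.
have sq (n : nat) (D : R) : 0 < D -> D <= A + B + C ->
    pi ^+ 2 / 2 * (n%:R ^+ 2 / D) <= lam ->
    n%:R <= Num.sqrt (lam / (pi ^+ 2 / 2 / (A + B + C))).
  move=> D0 DABC le.
  rewrite -[leLHS]ger0_norm// -sqrtr_sqr ler_wsqrtr//.
  rewrite ler_pdivlMr// mulrC; apply: le_trans le.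
  rewrite -[leLHS]mulrA ler_pM2l// mulrC ler_wpM2l ?sqr_ge0//.
  by rewrite lef_pV2 ?posrE.
have q (n : nat) (D : R) : 0 < D -> 0 <= n%:R ^+ 2 / D.
  by move=> D0; rewrite divr_ge0 ?sqr_ge0// ltW.
move: (q m1.+1 _ A0) (q m2.+1 _ B0) (q m3.+1 _ C0) => q1 q2 q3.
by split; [apply: (sq _ A)|apply: (sq _ B)|apply: (sq _ C)];
  rewrite ?(le_trans _ Elam) ?ler_pM2l//; lra.
Qed.

Lemma Eone_ge0 m : 0 <= Eone R a1 a2 a3 V m.
Proof.
have p0 : 0 <= pi ^+ 2 / 2 :> R by rewrite divr_ge0// sqr_ge0.
by rewrite /Eone mulr_ge0// !addr_ge0// divr_ge0// sqr_ge0.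
Qed.

Lemma levels_lb k : (0 < k)%N -> lbound (levels k) 0.
Proof.
move=> k0 lam [f [_ /(_ (Ordinal k0))]]; apply: le_trans; exact: Eone_ge0.
Qed.

Lemma levels_nonempty k : levels k !=set0.
Proof.
pose f (i : 'I_k) : nat * nat * nat := (nat_of_ord i, 0%N, 0%N).
exists (\sum_i Eone R a1 a2 a3 V (f i)); exists f; split.
  by move=> i j [/val_inj].
by move=> i; rewrite (bigD1 i)//= lerDl sumr_ge0// => j _; exact: Eone_ge0.
Qed.

Lemma Eig1_le k : (0 < k)%N -> Eig R a1 a2 a3 V 1 <= Eig R a1 a2 a3 V k.
Proof.
move=> k0; apply: lb_le_inf; first exact: levels_nonempty.
move=> lam [f [injf fle]]; apply: ge_inf; first by exists 0; exact: levels_lb.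
exists (fun=> f (Ordinal k0)); split => // i j _.
by rewrite [i]ord1 [j]ord1.
Qed.

(* All states below [lam] have quantum numbers at most [y = sqrt (lam / c)], so
   there are at most [y ^ 3] of them. *)
Lemma levels_count : exists2 c, 0 < c &
  forall k lam, (0 < k)%N -> levels k lam -> k%:R ^+ 2 <= (lam / c) ^+ 3.
Proof.
have [c c0 hc] := Eone_le_sqrt; exists c => // k lam k0 hl.
have lam0 := levels_lb k0 hl; case: hl => f [injf fle].
set y := Num.sqrt (lam / c).
have y0 : 0 <= y by exact: sqrtr_ge0.
pose D := Num.truncn y.
have fD i : [/\ (f i).1.1 < D, (f i).1.2 < D & (f i).2 < D]%N.
  by have [h1 h2 h3] := hc _ _ (fle i); rewrite !truncn_ge_nat.
have DD : D.-1.+1 = D.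
  by rewrite prednK//; have [] := fD (Ordinal k0); case: (D).
pose g i : 'I_D.-1.+1 * 'I_D.-1.+1 * 'I_D.-1.+1 :=
  (inord (f i).1.1, inord (f i).1.2, inord (f i).2).
have injg : injective g.
  move=> i j [/(congr1 val) e1 /(congr1 val) e2 /(congr1 val) e3]; apply: injf.
  move: e1 e2 e3; have [i1 i2 i3] := fD i; have [j1 j2 j3] := fD j.
  rewrite /= !inordK ?DD//.
  by case: (f i) (f j) => [[? ?] ?] [[? ?] ?] /= -> -> ->.
have := leq_card g injg; rewrite !card_prod !card_ord DD => kD.
have Dy : D%:R <= y by rewrite -truncn_ge_nat.
have ky : k%:R <= y ^+ 3.
  apply: (@le_trans _ _ ((D * D * D)%:R)); first by rewrite ler_nat.
  by rewrite !natrM -!expr2 -exprSr lerXn2r ?nnegrE.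
have -> : (lam / c) ^+ 3 = (y ^+ 3) ^+ 2.
  by rewrite -exprM mulnC exprM sqr_sqrtr// divr_ge0// ltW.
by rewrite lerXn2r ?nnegrE// exprn_ge0.
Qed.

(** By [levels_count] the [l]-th eigenvalue is at least of order [l ^ (2/3)]; bounding the
    exponential below by a cube then gives terms of order [l ^ (-2)]. *)
Lemma Boltzmann_summable beta : 0 < beta -> exists s, forall L,
  \sum_(l < L) expR (- beta * Eig R a1 a2 a3 V l.+1) <= s.
Proof.
move=> b0; have [c c0 hc] := levels_count.
pose K := (beta * c / 3) ^+ 3.
have K0 : 0 < K by rewrite exprn_gt0// divr_gt0// mulr_gt0.
have bound l : expR (- beta * Eig R a1 a2 a3 V l.+1) <= K^-1 * (l.+1%:R ^+ 2)^-1.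
  have l0 : 0 < l.+1%:R ^+ 2 :> R by rewrite exprn_gt0.
  have Kl : 0 < K * l.+1%:R ^+ 2 by rewrite mulr_gt0.
  rewrite -invfM mulNr expRN lef_pV2 ?posrE ?expR_gt0//.
  (* Taking logarithms isolates the infimum [Eig], so the bound need only be checked for each [lam]
     in its defining set. *)
  rewrite -[leLHS]lnK ?posrE// ler_expR [leRHS]mulrC -ler_pdivrMr//.
  apply: lb_le_inf; first exact: levels_nonempty.
  move=> lam hl; have lam0 := levels_lb (ltn0Sn l) hl.
  rewrite ler_pdivrMr// -ler_expR lnK ?posrE// [lam * _]mulrC.
  have -> : expR (beta * lam) = expR (beta * lam / 3) ^+ 3.
    by rewrite -expRM_natl; congr expR; field.
  apply: (@le_trans _ _ ((beta * lam / 3) ^+ 3)).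
    have -> : (beta * lam / 3) ^+ 3 = (lam / c) ^+ 3 * K.
      by rewrite /K; field; rewrite gt_eqF.
    by rewrite mulrC ler_pM2r// hc.
  have bl0 : 0 <= beta * lam / 3 by rewrite divr_ge0// mulr_ge0// ltW.
  rewrite lerXn2r ?nnegrE ?expR_ge0//.
  by apply: le_trans (expR_ge1Dx _); lra.
exists (K^-1 * 2) => L.
apply: (@le_trans _ _ (\sum_(l < L) K^-1 * (l.+1%:R ^+ 2)^-1)).
  by apply: ler_sum => l _; exact: bound.
rewrite -mulr_sumr ler_pM2l ?invr_gt0//.
(* Strengthened for induction: [1 / u ^ 2 <= 2 / u - 2 / (u + 1)] when [u >= 1]. *)
suff : \sum_(l < L) (l.+1%:R ^+ 2)^-1 <= 2 - 2 / L.+1%:R :> R.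
  by move/le_trans; apply; rewrite gerBl divr_ge0.
elim: L => [|L IH]; first by rewrite big_ord0 divr1 subrr.
rewrite big_ord_recr/=; apply: le_trans (lerD IH (lexx _)) _.
rewrite -[L.+2%:R]natr1.
have : 1 <= L.+1%:R :> R by rewrite ler1n.
move: (L.+1%:R : R) => u u1.
rewrite -subr_ge0.
have -> : 2 - 2 / (u + 1) - (2 - 2 / u + (u ^+ 2)^-1) = (u - 1) / (u ^+ 2 * (u + 1)).
  by field; apply/andP; split; apply/eqP; lra.
by rewrite divr_ge0 ?mulr_ge0 ?sqr_ge0//; lra.
Qed.

End Spectrum.

(** * Comparison of the two ensembles at a fixed volume *)

Section Bound.
Variables (R : realType) (a1 a2 a3 beta V : R).
Hypotheses (beta_gt0 : 0 < beta) (V_gt0 : 0 < V).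

Lemma fine_esum_series (u : R^nat) : (forall n, 0 <= u n) -> cvgn (series u) ->
  fine (\esum_(n in [set: nat]) (u n)%:E) = limn (series u).
Proof.
move=> u0 cu; rewrite -nneseries_esumT; last by move=> n; rewrite lee_fin.
rewrite (_ : (fun n => _) = EFin \o series u); first by rewrite EFin_lim.
by apply/funext => n; rewrite /series/= sumEFin.
Qed.

Let x l := expR (- beta * Eig R a1 a2 a3 V l).
Let h := mset_sum x.

Let x_gt0 l : 0 < x l. Proof. exact: expR_gt0. Qed.

Let x_le l : (0 < l)%N -> x l <= x 1%N.
Proof. by move=> l0; rewrite ler_expR !mulNr lerN2 ler_pM2l// Eig1_le. Qed.

Let weightE n (t : n.-tuple nat) :
  weight R a1 a2 a3 beta V n t = mset_weight x t.
Proof. by rewrite /weight mulr_sumr expR_sum. Qed.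

Lemma ZcE n : Zc R a1 a2 a3 beta V n = h n.
Proof. by congr fine; apply: eq_esum => t _; rewrite weightE. Qed.

Lemma TrNkE n k : TrNk R a1 a2 a3 beta V n k = mset_occ x k n.
Proof. by congr fine; apply: eq_esum => t _; rewrite weightE. Qed.

Lemma expR_mu_exp mu n : expR (beta * mu * n%:R) = expR (beta * mu) ^+ n.
Proof. by rewrite mulrC expRM_natl. Qed.

Section Grand.
Variable mu : R.
Hypothesis mu_lt : mu < Eig R a1 a2 a3 V 1.

Let z := expR (beta * mu).
Let p i := h i * z ^+ i.

Let s := sval (cid (Boltzmann_summable a1 a2 a3 V_gt0 beta_gt0)).
Let x_sum L : \sum_(l < L) x l.+1 <= s.
Proof. by rewrite /s; case: cid. Qed.

Let h_gt0 i : 0 < h i. Proof. exact: mset_sum_gt0 x_le x_sum i. Qed.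

Let z_gt0 : 0 < z. Proof. exact: expR_gt0. Qed.

Let zx : z * x 1%N < 1.
Proof.
rewrite /z /x -expRD -expR0 ltr_expR mulNr -mulrBr pmulr_rlt0// subr_lt0.
exact: mu_lt.
Qed.

Let p_gt0 i : 0 < p i.
Proof. by rewrite mulr_gt0// exprn_gt0. Qed.

Let cvp : cvgn (series p).
Proof. exact: is_cvg_mset_sum_pseries x_le x_sum z z_gt0 zx. Qed.

Let lcp : log_concave p.
Proof.
move=> n; have := log_concave_mset_sum x_gt0 x_le x_sum n.
rewrite -(ler_pM2r (exprn_gt0 n.+1.*2 z_gt0)) /p -/h.
suff -> : (h n * z ^+ n) * (h n.+2 * z ^+ n.+2) =
          h n * h n.+2 * z ^+ n.+1.*2.
  by rewrite exprMn -exprM muln2.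
rewrite mulrACA -exprD; congr (_ * z ^+ _); lia.
Qed.

Let cvmean : cvgn (series (fun i => i%:R * p i)).
Proof.
pose y := (z + (x 1%N)^-1) / 2.
have zy : z < (x 1%N)^-1 by rewrite -[ltRHS]mul1r ltr_pdivlMr.
have y0 : 0 < y by rewrite /y; move: z_gt0 zy; lra.
have yx : y * x 1%N < 1 by rewrite -ltr_pdivlMr// mul1r /y; move: zy; lra.
have cy := is_cvg_mset_sum_pseries x_gt0 x_le x_sum y0 yx.
have zy' : `|z| < `|y|.
  by rewrite !gtr0_norm// /y; move: zy; lra.
have cD := is_cvg_pseries_diffs_equiv (is_cvg_pseries_diffs cy zy').
rewrite (_ : (fun i => _) = z *: (fun i => i%:R * h i * z ^+ i.-1)).
  exact: is_cvg_seriesZ.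
apply/funext => i; change (i%:R * p i = z * (i%:R * h i * z ^+ i.-1)).
case: i => [|i]; first by rewrite !mul0r mulr0.
by rewrite /p exprS /=; ring.
Qed.

Let F := limn (series p).

Let F_gt0 : 0 < F.
Proof.
apply: lt_le_trans (p_gt0 0) _.
have -> : p 0%N = series p 1 by rewrite seriesSr /series/= big_nil add0r.
apply: nondecreasing_cvgn_le cvp 1%N.
by apply: nondecreasing_nneg_series => n; exact: ltW.
Qed.

Lemma XiE : Xi R a1 a2 a3 beta V mu = F.
Proof.
rewrite /Xi /F -fine_esum_series//; last by move=> n; exact: ltW.
by congr fine; apply: eq_esum => n _; rewrite ZcE expR_mu_exp mulrC.
Qed.

Lemma Xi_gt0 : 0 < Xi R a1 a2 a3 beta V mu.
Proof. by rewrite XiE F_gt0. Qed.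

Lemma gcNE : gcN R a1 a2 a3 beta V mu = limn (series (fun i => i%:R * p i)) / F.
Proof.
rewrite /gcN XiE -fine_esum_series//; last by move=> n; rewrite mulr_ge0// ltW.
congr (fine _ / _); apply: eq_esum => n _.
by rewrite ZcE expR_mu_exp -mulrA [_ * h n]mulrC.
Qed.

(* The canonical occupation of the level [k] increases with the number of
   particles, so the grand-canonical one is at least the canonical one at [n]
   times the probability of having at least [n] particles. *)
Lemma canNk_le_gcNk n k : (0 < k)%N -> gcN R a1 a2 a3 beta V mu = n%:R ->
  0 <= canNk R a1 a2 a3 beta V n k <= 4 * (gcNk R a1 a2 a3 beta V mu k / V).
Proof.
move=> k0 mean; pose T := mset_occ x k.
have T0 i : 0 <= T i by exact: (mset_occ_ge0 x_gt0 x_le x_sum).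
have tail : F <= 4 * (F - series p n).
  apply: log_concave_mean_tail => //.
  have : limn (series (fun i => i%:R * p i)) = n%:R * F.
    by rewrite -mean gcNE divfK// gt_eqF.
  by move=> <-.
have homoT : {homo (fun i => T i / h i) : i j / (i <= j)%N >-> i <= j}.
  apply/nondecreasing_seqP => i.
  apply: (@ratio_homo_geometric_conv _ h T (x k)) => //.
  - exact: (log_concave_mset_sum x_gt0 x_le x_sum).
  - exact: mset_occ0.
  - by move=> j; exact: (mset_occS x_gt0 x_le x_sum).
have Tz0 i : 0 <= T i * z ^+ i by rewrite mulr_ge0// exprn_ge0// ltW.
have cvT : cvgn (series (fun i => T i * z ^+ i)).
  apply: (@series_le_cvg _ _ (fun i => p i + i%:R * p i)) => //.
  - by move=> i; have pi0 := ltW (p_gt0 i); rewrite addr_ge0// mulr_ge0.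
  - move=> i; have -> : p i + i%:R * p i = i.+1%:R * h i * z ^+ i.
      by rewrite /p -natr1; ring.
    by rewrite ler_pM2r ?exprn_gt0//; exact: (mset_occ_le x_gt0 x_le x_sum).
  - exact: is_cvg_seriesD.
have -> : gcNk R a1 a2 a3 beta V mu k = limn (series (fun i => T i * z ^+ i)) / F.
  rewrite /gcNk XiE -fine_esum_series//.
  by congr (fine _ / _); apply: eq_esum => i _; rewrite TrNkE expR_mu_exp mulrC.
rewrite /canNk ZcE TrNkE -/T.
have r0 : 0 <= T n / h n by rewrite divr_ge0// ltW.
apply/andP; split; first by rewrite divr_ge0// ltW.
rewrite mulrA ler_pM2r ?invr_gt0// mulrA ler_pdivlMr//.
apply: (@le_trans _ _ (T n / h n * (4 * (F - series p n)))).
  by rewrite ler_wpM2l.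
rewrite mulrCA ler_pM2l//.
rewrite mulrBr lerBlDr.
have -> : T n / h n * F = limn (fun N => T n / h n * series p N).
  by apply/esym/cvg_lim => //; exact: cvgMl_tmp.
apply: limr_le; first exact: is_cvgMl_tmp.
exists n => // N /= nN; rewrite -lerBlDr -mulrBr.
have homoS := nondecreasing_nneg_series Tz0.
apply: le_trans (nondecreasing_cvgn_le homoS cvT N).
rewrite sub_series nN mulr_sumr /series/= (@big_cat_nat _ _ _ n 0 N)//=.
rewrite ler_wpDl ?sumr_ge0//; rewrite big_nat_cond [leRHS]big_nat_cond.
apply: ler_sum => i /andP[/andP[ni _] _].
have -> : T i * z ^+ i = T i / h i * p i.
  by rewrite /p mulrA divfK// gt_eqF.
by rewrite ler_pM2r//; exact: homoT.
Qed.

End Grand.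

(** [muV] is an [xget] with default [0], so a solution must be exhibited: [ln z / beta], with [z]
    the fugacity of mean [n] given by [pseries_mean_exists] at [q = x 1]. *)
Lemma muV_spec (rho : R) n : (0 < n)%N -> V * rho = n%:R ->
  muV R a1 a2 a3 beta V rho < Eig R a1 a2 a3 V 1 /\
  gcN R a1 a2 a3 beta V (muV R a1 a2 a3 beta V rho) = n%:R.
Proof.
move=> n0 Vrho.
suff [m [m1 m2]] : exists mu, mu < Eig R a1 a2 a3 V 1 /\
    gcN R a1 a2 a3 beta V mu / V = rho.
  have [h1 h2] := xgetPex 0 (ex_intro
    (fun mu => mu < Eig R a1 a2 a3 V 1 /\ gcN R a1 a2 a3 beta V mu / V = rho)
    m (conj m1 m2)).
  by split => //; rewrite -Vrho -[in RHS]h2 mulrC divfK// gt_eqF.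
have [s x_sum] := Boltzmann_summable a1 a2 a3 V_gt0 beta_gt0.
have h_gt0 := mset_sum_gt0 x_gt0 x_le x_sum.
have [z [z0 zx mean]] := pseries_mean_exists n0 (x_gt0 1) h_gt0
  (mset_sum_ratio x_gt0 x_le x_sum) (is_cvg_mset_sum_pseries x_gt0 x_le x_sum).
have ez : expR (beta * (ln z / beta)) = z.
  by rewrite mulrC divfK ?gt_eqF// lnK.
have lt : ln z / beta < Eig R a1 a2 a3 V 1.
  rewrite ltr_pdivrMr// -subr_lt0 -ltr_expR expR0 expRD lnK ?posrE//.
  by rewrite [_ * beta]mulrC -mulNr.
exists (ln z / beta); split => //.
rewrite gcNE// ez (cvg_lim _ mean)//.
have F0 : 0 < limn (pseries (mset_sum x) z).
  by have := Xi_gt0 lt; rewrite XiE// ez.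
by rewrite mulfK ?gt_eqF// -Vrho mulrC mulKf// gt_eqF.
Qed.

End Bound.

Theorem theorem3p3 (R : realType) (a1 a2 a3 beta : R)
  (ha12 : a2 <= a1) (ha23 : a3 <= a2) (ha3 : 0 < a3)
  (hsum : a1 + a2 + a3 = 1) (hbeta : 0 < beta)
  (k : nat) (hk : (1 <= k)%N) (rho : R) (hrho : 0 < rho)
  (f : R -> R) (K : R -> probability R R)
  (* f(rho') = lim_{V->oo} <N_k/V>^GC_V(mu_V(rho')) for rho' near rho *)
  (hf : \forall r \near rho,
          (fun V => gcNk_rho R a1 a2 a3 beta V r k) @ +oo --> f r)
  (* K(rho') = tilde K(rho'; .) = weak limit of tilde K_V(rho'; .) for rho' near rho *)
  (hK : \forall r \near rho, kac_weak_limit R a1 a2 a3 beta r (K r))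
  (hfc : {for rho, continuous f})
  (hKc : {for rho, continuous (fun r => fine (K r [set x | rho <= x]))})
  (hK0 : K rho [set x | rho <= x] != 0%E) :
  f rho = 0 ->
  (fun n : nat => canNk R a1 a2 a3 beta (n%:R / rho) n k) @ \oo --> 0.
Proof.
move=> f0.
have gc0 : (fun n : nat => 4 * gcNk_rho R a1 a2 a3 beta (n%:R / rho) rho k)
    @ \oo --> 0.
  rewrite -[X in _ --> X](mulr0 4); apply: cvgMl_tmp; rewrite -f0.
  apply: (cvg_comp _ _ _ (nbhs_singleton hf)).
  apply/cvgryPge => A; near=> n.
  rewrite ler_pdivlMr//; near: n; exact: nbhs_infty_ger.
apply: (squeeze_cvgr _ (cvg_cst 0) gc0).
(* At [n = 0] the volume [n / rho] is zero, so the comparison starts at [n = 1]. *)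
exists 1%N => // n /= n0.
have V0 : 0 < n%:R / rho by rewrite divr_gt0// ltr0n.
have Vrho : n%:R / rho * rho = n%:R by rewrite divfK// gt_eqF.
have [mu_lt mean] := muV_spec a1 a2 a3 hbeta V0 n0 Vrho.
exact: canNk_le_gcNk.
Unshelve. all: by end_near. Qed.
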